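(* Let $E$ be an $n$-dimensional vector space over a field $\mathbb{F}$ and let $\mathcal{S}\subseteq\mathcal{L}(E)$ be a family of subspaces satisfying (S1), (S2) and (nS3). Then $\mathcal{S}$ is the family of spanning spaces of a $q$-matroid with ground space $E$.
   Context: $n$ is a positive integer, $\mathbb{F}$ is an arbitrary field, and $\mathcal{L}(E)$ denotes the lattice of all subspaces of $E$. Axioms for $\mathcal{S}\subseteq\mathcal{L}(E)$: (S1) $E\in\mathcal{S}$. (S2) For all $I,J\in\mathcal{L}(E)$, if $J\in\mathcal{S}$ and $J\subseteq I$, then $I\in\mathcal{S}$. (nS3) For all $S_1,S_2\in\mathcal{S}$ satisfying $\dim S_2<\dim S_1$, there exists a $1$-dimensional subspace $x\subseteq S_1$, $x\not\subseteq S_2$ such that for all codimension-one $X\subseteq E$ with $X\not\supseteq x$ we have $X\cap S_1\in\mathcal{S}$. A $q$-matroid $M$ with ground space $E$ is a pair $(E,r)$ where $r$ is an integer-valued function on $\mathcal{L}(E)$ such that: (R1) $0\leq r(A)\leq\dim A$ for all $A\in\mathcal{L}(E)$; (R2) $r(A)\leq r(B)$ for all $A\subseteq B$ in $\mathcal{L}(E)$; (R3) $r(A+B)+r(A\cap B)\leq r(A)+r(B)$ for all $A,B\in\mathcal{L}(E)$. A spanning space of $M$ is a subspace $S$ of $E$ with $r(S)=r(E)$. *)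

(* Defs.v *)
From mathcomp Require Import all_boot all_order all_algebra.
Set Implicit Arguments.
Unset Strict Implicit.
Unset Printing Implicit Defensive.
Import Order.TTheory GRing.Theory Num.Theory.
Local Open Scope ring_scope.

(* The field may be infinite, so a family of subspaces is an
   arbitrary Prop-valued predicate on {vspace E}. *)

Section QMatroid.
Variables (F : fieldType) (E : vectType F).

Record qmatroid : Type := QMatroid {
  qrank :> {vspace E} -> int;
  qrank_bound : forall A : {vspace E}, 0 <= qrank A <= (\dim A)%:Z;
  qrank_mono : forall A B : {vspace E}, (A <= B)%VS -> qrank A <= qrank B;
  qrank_submod : forall A B : {vspace E},
    qrank (A + B)%VS + qrank (A :&: B)%VS <= qrank A + qrank B
}.

Definition spanning_space (M : qmatroid) (A : {vspace E}) : Prop :=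
  M A = M fullv.

Definition axiom_S1 (S : {vspace E} -> Prop) : Prop := S fullv.

Definition axiom_S2 (S : {vspace E} -> Prop) : Prop :=
  forall I J : {vspace E}, S J -> (J <= I)%VS -> S I.

Definition codim_one (X : {vspace E}) : Prop :=
  (\dim X).+1 = \dim (fullv : {vspace E}).

Definition axiom_nS3 (S : {vspace E} -> Prop) : Prop :=
  forall S1 S2 : {vspace E}, S S1 -> S S2 -> (\dim S2 < \dim S1)%N ->
    exists x : {vspace E},
      [/\ \dim x = 1%N, (x <= S1)%VS, ~~ (x <= S2)%VS &
          forall X : {vspace E}, codim_one X -> ~~ (x <= X)%VS ->
            S (X :&: S1)%VS].

End QMatroid.

(* Main.v *)
Require Import Defs.
From mathcomp Require Import all_boot all_order all_algebra.
From mathcomp Require Import boolp zify.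

(** The rank function can be read off the spanning spaces.  In a q-matroid,
    completing [A] to a spanning space takes at least [r(E) - r(A)] further
    dimensions, and this many suffice.  So, writing [g(A)] for the least
    dimension of a member of [S] that contains [A] ([span_dim] below), the
    only candidate is [r(A) = g(0) + dim A - g(A)], where [g(0)] is the
    dimension of the smallest members of [S].

    Boundedness and monotonicity of [r] amount to
    [g(A) <= g(B) <= g(A) + dim B - dim A] for [A <= B], which follows from
    upward closure of [S]; and [r(A) = r(E)] says [g(A) = dim A], that is,
    [A] belongs to [S].

    Submodularity of [r] is supermodularity of [g].  As for any function on
    subspaces, it is enough to treat [A] and [B] of dimension one above
    [A :&: B] ([local_supermodular]).  There, a failure forces
    [g(A) = g(B) = g(A + B) = g(A :&: B) + 1]; the exchange axiom, applied to
    optimal members [T1] above [A + B] and [T2] above [A :&: B], gives a line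
    [x] of [T1] outside [T2].  Were [x] outside [A], a hyperplane through [A]
    avoiding [x] would cut [T1] in a member above [A] that is too small; so
    [x] lies in [A], likewise in [B], hence in [A :&: B], hence in [T2], a
    contradiction ([span_dim_local]). *)

Set Implicit Arguments.
Unset Strict Implicit.
Unset Printing Implicit Defensive.
Import Order.TTheory GRing.Theory Num.Theory.

Section Subspaces.
Variables (F : fieldType) (E : vectType F).
Implicit Types A B C X x : {vspace E}.

(** Complement [A + x] and add [A] back: what is lost is only [x]. *)
Lemma hyperplane_avoiding_line A x : \dim x = 1 -> ~~ (x <= A)%VS ->
  exists X, [/\ codim_one X, (A <= X)%VS & ~~ (x <= X)%VS].
Proof.
move=> dx nxA; pose X := (A + (A + x)^C)%VS.
have ltA : \dim A < \dim (A + x).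
  rewrite ltn_neqAle dimvS ?addvSl // andbT; apply: contra nxA => /eqP eqd.
  have /eqP -> : A == (A + x)%VS by rewrite eqEdim addvSl eqd /=.
  exact: addvSr.
have XxE : (X + x)%VS = fullv.
  by rewrite /X -addvA (addvC _ x) addvA addv_complf.
have dXx := dimv_add_leqif X x; rewrite XxE dx in dXx.
have [dX _] := dimv_add_leqif A (A + x)^C.
have dC := dimv_compl (A + x); rewrite -/X in dX.
have le_Ax := dimvS (subvf (A + x)).
have cX : codim_one X by rewrite /codim_one; case: dXx => dXx _; lia.
exists X; split=> //; first exact: addvSl.
apply/negP => /addv_idPl xX; move: cX; rewrite /codim_one -XxE xX; lia.
Qed.

Lemma intermediate_subspace C A : (C <= A)%VS -> (\dim C).+1 < \dim A ->
  exists A', [/\ (C <= A')%VS, (A' <= A)%VS & \dim C < \dim A' < \dim A].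
Proof.
move=> CA ltCA.
have /subvPn[v vA vC] : ~~ (A <= C)%VS.
  by apply/negP => /dimvS; lia.
exists (C + <[v]>)%VS; split; first exact: addvSl.
  by rewrite subv_add CA.
have [le1 _] := dimv_add_leqif C <[v]>; have := dim_vline v.
have ltC : \dim C < \dim (C + <[v]>).
  rewrite ltn_neqAle dimvS ?addvSl // andbT; apply: contra vC => /eqP eqd.
  have /eqP -> : C == (C + <[v]>)%VS by rewrite eqEdim addvSl eqd /=.
  by rewrite memvE addvSr.
by case: eqP => _ /= dv; lia.
Qed.

(** A subspace [A'] strictly between [A :&: B] and [A] splits the square
    [A :&: B, A, B, A + B] into the squares of [A', B] and of [A, A' + B],
    by the modular law; the two inequalities add up. *)
Lemma local_supermodular (g : {vspace E} -> nat) :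
    (forall A B, \dim A = (\dim (A :&: B)).+1 ->
       \dim B = (\dim (A :&: B)).+1 ->
       g A + g B <= g (A + B)%VS + g (A :&: B)%VS) ->
  forall A B, g A + g B <= g (A + B)%VS + g (A :&: B)%VS.
Proof.
move=> loc A B.
have [m] := ubnP ((\dim A - \dim (A :&: B)) + (\dim B - \dim (A :&: B))).
elim: m A B => // m IH A B.
wlog leBA : A B / \dim B <= \dim A.
  move=> W; have [|/ltnW leAB ltm] := leqP (\dim B) (\dim A); first exact: W.
  by rewrite addvC capvC [g A + _]addnC; apply: W; rewrite // capvC; lia.
move=> ltm.
have [BA|nBA] := boolP (B <= A)%VS.
  by rewrite (addv_idPl BA) (capv_idPr BA).
have ltCB : \dim (A :&: B) < \dim B.
  rewrite ltn_neqAle dimvS ?capvSr // andbT; apply: contra nBA => /eqP eqd.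
  have /eqP <- : (A :&: B)%VS == B by rewrite eqEdim capvSr eqd /=.
  exact: capvSl.
have [ltCA|leAC] := ltnP (\dim (A :&: B)).+1 (\dim A); last by apply: loc; lia.
have [A' [CA' A'A /andP[ltCA' ltA'A]]] :=
  intermediate_subspace (capvSl A B) ltCA.
have capA'B : (A' :&: B)%VS = (A :&: B)%VS.
  apply/eqP; rewrite eqEsubv subv_cap (subv_trans (capvSl _ _) A'A) capvSr /=.
  by rewrite subv_cap CA' capvSr.
have capAA'B : (A :&: (A' + B))%VS = A'.
  by rewrite addvC -vspace_modr // (addv_idPr CA').
have addAA'B : (A + (A' + B))%VS = (A + B)%VS by rewrite addvA (addv_idPl A'A).
have dA'B := dimv_sum_cap A' B; rewrite capA'B in dA'B.
have IH1 : g A' + g B <= g (A' + B)%VS + g (A :&: B)%VS.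
  by rewrite -capA'B; apply: IH; rewrite capA'B; lia.
have IH2 : g A + g (A' + B)%VS <= g (A + B)%VS + g A'.
  by rewrite -{2}capAA'B -addAA'B; apply: IH; rewrite capAA'B; lia.
lia.
Qed.

End Subspaces.

Section SpanningDimension.
Variables (F : fieldType) (E : vectType F) (S : {vspace E} -> Prop).
Hypotheses (S1 : axiom_S1 S) (S2 : axiom_S2 S).
Implicit Types A B T : {vspace E}.

Lemma ex_member_above A :
  exists d, `[< exists T, [/\ S T, (A <= T)%VS & \dim T = d] >].
Proof.
by exists (\dim (fullv : {vspace E})); apply/asboolP; exists fullv; rewrite subvf.
Qed.

Definition span_dim A := ex_minn (ex_member_above A).

Lemma span_dim_attained A :
  exists T, [/\ S T, (A <= T)%VS & \dim T = span_dim A].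
Proof. by rewrite /span_dim; case: ex_minnP => d /asboolP. Qed.

Lemma span_dim_le A T : S T -> (A <= T)%VS -> span_dim A <= \dim T.
Proof.
rewrite /span_dim => ST AT; case: ex_minnP => d _; apply.
by apply/asboolP; exists T.
Qed.

Lemma span_dim_mono A B : (A <= B)%VS -> span_dim A <= span_dim B.
Proof.
move=> AB; have [T [ST BT <-]] := span_dim_attained B.
exact: span_dim_le (subv_trans AB BT).
Qed.

(** If [T] is optimal above [A], then [T + B] is a member above [B], and its
    dimension is small because [T] and [B] share [A]. *)
Lemma span_dim_growth A B : (A <= B)%VS ->
  span_dim B + \dim A <= span_dim A + \dim B.
Proof.
move=> AB; have [T [ST AT <-]] := span_dim_attained A.
have := span_dim_le (S2 ST (addvSl T B)) (addvSr T B).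
have /dimvS : (A <= T :&: B)%VS by rewrite subv_cap AT.
have := dimv_sum_cap T B; lia.
Qed.

Lemma dim_le_span_dim A : \dim A <= span_dim A.
Proof. by have [T [_ /dimvS ? <-]] := span_dim_attained A. Qed.

Lemma span_dim_eq_dim A : S A <-> span_dim A = \dim A.
Proof.
split=> [SA|eqd].
  by apply/eqP; rewrite eqn_leq dim_le_span_dim span_dim_le.
have [T [ST AT dT]] := span_dim_attained A.
by have /eqP -> : A == T by rewrite eqEdim AT dT eqd /=.
Qed.

Lemma span_dim_fullv : span_dim fullv = \dim (fullv : {vspace E}).
Proof. exact/span_dim_eq_dim. Qed.

Hypothesis nS3 : axiom_nS3 S.

Lemma span_dim_local A B :
    \dim A = (\dim (A :&: B)).+1 -> \dim B = (\dim (A :&: B)).+1 ->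
  span_dim A + span_dim B <= span_dim (A + B)%VS + span_dim (A :&: B)%VS.
Proof.
move=> dA dB; rewrite leqNgt; apply/negP => fails.
have gA := span_dim_growth (capvSl A B).
have gB := span_dim_growth (capvSr A B).
have mA := span_dim_mono (addvSl A B); have mB := span_dim_mono (addvSr A B).
have [T1 [ST1 ABT1 dT1]] := span_dim_attained (A + B).
have [T2 [ST2 CT2 dT2]] := span_dim_attained (A :&: B).
have ltT : \dim T2 < \dim T1 by lia.
have [x [dx xT1 nxT2 cut]] := nS3 ST1 ST2 ltT.
have x_in D : (D <= A + B)%VS -> span_dim D = \dim T1 -> (x <= D)%VS.
  move=> DAB gD; apply: contraT => nxD.
  have [X [cX DX nxX]] := hyperplane_avoiding_line dx nxD.
  have := span_dim_le (cut X cX nxX) (_ : D <= X :&: T1)%VS.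
  rewrite subv_cap DX (subv_trans DAB ABT1) gD => /(_ isT) le_dim.
  have /eqP eqX : (X :&: T1)%VS == T1 by rewrite eqEdim capvSr.
  by move: nxX; rewrite (subv_trans xT1) // -eqX capvSl.
case/negP: nxT2; apply: subv_trans CT2.
by rewrite subv_cap !x_in ?addvSl ?addvSr //; lia.
Qed.

Definition span_rank A : int :=
  ((span_dim 0%VS + \dim A)%:Z - (span_dim A)%:Z)%R.

Lemma span_rank_bound A : (0 <= span_rank A <= (\dim A)%:Z)%R.
Proof.
have := span_dim_growth (sub0v A); have := span_dim_mono (sub0v A).
rewrite /span_rank dimv0; lia.
Qed.

Lemma span_rank_mono A B : (A <= B)%VS -> (span_rank A <= span_rank B)%R.
Proof. by move=> /span_dim_growth; rewrite /span_rank; lia. Qed.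

Lemma span_rank_submod A B :
  (span_rank (A + B)%VS + span_rank (A :&: B)%VS
     <= span_rank A + span_rank B)%R.
Proof.
have := local_supermodular span_dim_local A B; have := dimv_sum_cap A B.
rewrite /span_rank; lia.
Qed.

Definition span_qmatroid : qmatroid E :=
  QMatroid span_rank_bound span_rank_mono span_rank_submod.

Lemma span_qmatroidP A : S A <-> spanning_space span_qmatroid A.
Proof.
rewrite span_dim_eq_dim /spanning_space /= /span_rank span_dim_fullv.
split; lia.
Qed.

End SpanningDimension.

Theorem theorem32 (F : fieldType) (n : nat) (n_gt0 : (0 < n)%N)
    (E : vectType F) (dimE : \dim (fullv : {vspace E}) = n)
    (S : {vspace E} -> Prop) :
  axiom_S1 S -> axiom_S2 S -> axiom_nS3 S ->
  exists M : qmatroid E,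
    forall A : {vspace E}, S A <-> spanning_space M A.
Proof.
by move=> S1 S2 nS3; exists (span_qmatroid S1 S2 nS3); apply: span_qmatroidP.
Qed.
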